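(* Let $k\ge1$ be an integer and let $G$ be a finite graph. Assume that $G$ is $(k-1)$-connected, and that every pair $x,y$ of adjacent vertices of $G$ has at least one of the following properties: (i) $x$ and $y$ have at least $k-3$ common neighbours; (ii) $x$ and $y$ are joined by at least $\lfloor\frac32(k-2)\rfloor$ independent paths other than the edge $xy$; (iii) $x$ and $y$ lie in a common $k$-block. Then $G$ has a canonical tree-decomposition of adhesion $<k$ such that every part containing a $k$-block is a $k$-block. In particular, distinct $k$-blocks are contained in different parts.
   Context: A $k$-block of $G$ is a maximal set $X$ of at least $k$ vertices such that no two vertices $x,x'\in X$ can be separated in $G$ by fewer than $k$ vertices other than $x$ and $x'$. $G$ is $(k-1)$-connected if it has more than $k-1$ vertices and no set of fewer than $k-1$ vertices separates it. Paths between $x$ and $y$ are independent if they are pairwise disjoint apart from their endvertices $x,y$. For a tree-decomposition $(T,(V_t)_{t\in T})$ of $G$, the sets $V_t$ are its parts; it has adhesion $<k$ if $|V_t\cap V_{t'}|<k$ for every edge $tt'$ of $T$. It is canonical if it is invariant under the automorphisms of $G$: for every automorphism $\alpha$ of $G$ there is an automorphism $\varphi$ of $T$ with $\alpha(V_t)=V_{\varphi(t)}$ for all $t\in T$. *)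

(* Defs.v *)
From HB Require Import structures.
From mathcomp Require Import all_boot all_fingroup.

Set Implicit Arguments.
Unset Strict Implicit.
Unset Printing Implicit Defensive.

(* A finite graph is a symmetric irreflexive relation on a finType. *)
Definition simple_graph (V : finType) (e : rel V) : Prop :=
  symmetric e /\ irreflexive e.

Definition del_verts (V : finType) (e : rel V) (S : {set V}) : rel V :=
  [rel u v | [&& u \notin S, v \notin S & e u v]].

Definition separates_pair (V : finType) (e : rel V) (S : {set V}) (x y : V) :
    bool :=
  [&& x \notin S, y \notin S & ~~ connect (del_verts e S) x y].

Definition separates (V : finType) (e : rel V) (S : {set V}) : bool :=
  [exists x, exists y, separates_pair e S x y].

Definition n_connected (V : finType) (e : rel V) (n : nat) : Prop :=
  n < #|V| /\ forall S : {set V}, #|S| < n -> ~~ separates e S.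

Definition inseparable (V : finType) (e : rel V) (k : nat) (X : {set V}) :
    bool :=
  [forall x in X, forall y in X, forall S : {set V},
     (x != y) && (#|S| < k) ==> ~~ separates_pair e S x y].

Definition k_block (V : finType) (e : rel V) (k : nat) (X : {set V}) : bool :=
  maxset (fun Y : {set V} => (k <= #|Y|) && inseparable e k Y) X.

Definition common_neighbours (V : finType) (e : rel V) (x y : V) : {set V} :=
  [set z | e x z && e y z].

(* [x :: p] is the vertex sequence of an x-y path; for x != y, the edge xy
   is the path p = [:: y]. *)
Definition xy_path (V : finType) (e : rel V) (x y : V) (p : seq V) : Prop :=
  [/\ path e x p, uniq (x :: p) & last x p = y].

Definition independent_nonedge_paths
    (V : finType) (e : rel V) (x y : V) (m : nat) : Prop :=
  exists P : 'I_m -> seq V,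
    [/\ injective P,
        forall i, xy_path e x y (P i) /\ P i <> [:: y]
      & forall i j z, i != j -> z \in x :: P i -> z \in x :: P j ->
          z = x \/ z = y].

(* [ucycle] also accepts the closed walks u, v, u along a single edge, hence
   the bound 2. *)
Definition is_tree (T : finType) (f : rel T) : Prop :=
  [/\ simple_graph f, 0 < #|T|, forall s t, connect f s t
    & forall c : seq T, ucycle f c -> size c <= 2].

Definition tree_decomposition
    (V : finType) (e : rel V) (T : finType) (f : rel T)
    (part : T -> {set V}) : Prop :=
  [/\ is_tree f,
      forall x, exists t, x \in part t,
      forall x y, e x y -> exists t, x \in part t /\ y \in part t
    & forall (t1 t2 t3 : T) (p : seq T),
        xy_path f t1 t3 p -> t2 \in t1 :: p ->
        part t1 :&: part t3 \subset part t2].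

Definition adhesion_lt
    (V : finType) (T : finType) (f : rel T) (part : T -> {set V}) (k : nat) :
    Prop :=
  forall s t, f s t -> #|part s :&: part t| < k.

Definition automorphism (V : finType) (e : rel V) (a : {perm V}) : Prop :=
  forall x y, e (a x) (a y) = e x y.

Definition canonical_td
    (V : finType) (e : rel V) (T : finType) (f : rel T)
    (part : T -> {set V}) : Prop :=
  forall a : {perm V}, automorphism e a ->
    exists2 phi : {perm T}, automorphism f phi
      & forall t, a @: part t = part (phi t).

(* Main.v *)
(* Call (A, B) a separation if A and B cover V and no edge joins A \ B to
   B \ A.  A k-block X lies on one side of every separation of order < k, and
   the hypothesis on adjacent vertices forces |N(C)| < k for every component C
   of G - X.  Otherwise, among the separations (A, B) of order < k with X in A,
   take one that cuts off as much of C as possible: some edge xy of C has x cut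
   off but y not.  Let (A', B') be such a separation cutting off y.  By
   maximality the meet of the two has order at least k, so by submodularity and
   (k-1)-connectedness A and A' cover V and B & B' has fewer than k - 1
   vertices; this contradicts each of (i), (ii) and (iii) for xy.

   Hence |N(C)| = k - 1, which makes the separations (C + N(C), V \ C), over all
   k-blocks X and components C of G - X, nested.  They are permuted by the
   automorphisms of G and separate every k-block X from every vertex outside it,
   so the tree-decomposition that they induce is as desired.  Its nodes are the
   consistent orientations of these separations, two of them being adjacent if
   they differ on exactly one separation. *)

Require Import Defs.
From HB Require Import structures.
From mathcomp Require Import all_boot all_fingroup.
From mathcomp Require Import zify.

Set Implicit Arguments.
Unset Strict Implicit.
Unset Printing Implicit Defensive.

(** * The tree of a nested system of separations *)

Definition flip (V : finType) (s : {set V} * {set V}) := (s.2, s.1).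

(** The standard partial order on oriented separations, which [flip] reverses. *)
Definition sep_le (V : finType) (s r : {set V} * {set V}) :=
  (s.1 \subset r.1) && (r.2 \subset s.2).

Lemma flipK (V : finType) : involutive (@flip V).
Proof. by case. Qed.

Lemma sep_le_flip (V : finType) (s r : {set V} * {set V}) :
  sep_le (flip s) (flip r) = sep_le r s.
Proof. by rewrite /sep_le andbC. Qed.

Lemma sep_le_flipl (V : finType) (s r : {set V} * {set V}) :
  sep_le (flip s) r = sep_le (flip r) s.
Proof. by rewrite -sep_le_flip flipK. Qed.

Lemma sep_le_flipr (V : finType) (s r : {set V} * {set V}) :
  sep_le s (flip r) = sep_le r (flip s).
Proof. by rewrite -sep_le_flip flipK. Qed.

Lemma sep_le_trans (V : finType) (r s t : {set V} * {set V}) :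
  sep_le s r -> sep_le r t -> sep_le s t.
Proof.
move=> /andP[sr1 sr2] /andP[rt1 rt2].
by rewrite /sep_le (subset_trans sr1 rt1) (subset_trans rt2 sr2).
Qed.

Lemma imset_permKV (V : finType) (a : {perm V}) (S : {set V}) : a @: (a^-1%g @: S) = S.
Proof. by rewrite -imset_comp (eq_imset (g := id)) ?imset_id // => z; apply: permKV. Qed.

Lemma imset_permK (V : finType) (a : {perm V}) (S : {set V}) : a^-1%g @: (a @: S) = S.
Proof. by rewrite -imset_comp (eq_imset (g := id)) ?imset_id // => z; apply: permK. Qed.

Definition sep_act (V : finType) (a : {perm V}) (s : {set V} * {set V}) :=
  (a @: s.1, a @: s.2).

Lemma sep_act_inj (V : finType) (a : {perm V}) : injective (sep_act a).
Proof. by move=> [A B] [C D] [/(imset_inj perm_inj)-> /(imset_inj perm_inj)->]. Qed.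

Lemma sep_act_flip (V : finType) (a : {perm V}) s :
  sep_act a (flip s) = flip (sep_act a s).
Proof. by []. Qed.

Lemma sep_act_le (V : finType) (a : {perm V}) s r :
  sep_le (sep_act a s) (sep_act a r) = sep_le s r.
Proof.
have aS (A B : {set V}) : (a @: A \subset a @: B) = (A \subset B).
  apply/idP/idP => [/subsetP sAB|]; last exact: imsetS.
  by apply/subsetP => x xA; have := sAB _ (imset_f a xA); rewrite mem_imset //; apply: perm_inj.
by rewrite /sep_le !aS.
Qed.

Lemma imset_setD (aT rT : finType) (f : aT -> rT) (A B : {set aT}) :
  injective f -> f @: (A :\: B) = f @: A :\: f @: B.
Proof.
move=> f_inj; apply/setP => y; apply/imsetP/setDP.
  by case=> x /setDP[xA xB] ->; rewrite !mem_imset.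
by case=> /imsetP[x xA ->]; rewrite mem_imset // => xB; exists x; rewrite ?inE ?xB.
Qed.

Section TreeOfNestedSystem.

Variables (V : finType) (N : {set {set V} * {set V}}).
Implicit Types (s r : {set V} * {set V}) (o : {set {set V} * {set V}}).

(* The side of [s] that an orientation containing [s] points to is [s.2]. *)
Definition orientation o :=
  [&& o \subset N, [forall s in N, (flip s \in o) == (s \notin o)]
    & [forall s in N, forall r in o, sep_le s r ==> (s \in o)]].

Definition node : finType := {o : {set {set V} * {set V}} | orientation o}.

(** The one-sided difference suffices, because [flip] carries it bijectively onto the opposite
    difference. *)
Definition node_adj (x y : node) := #|val x :\: val y| == 1.

(** If [N] is empty, the only node is the empty orientation, and its part is all of [V]. *)
Definition node_part (x : node) := \bigcap_(s in val x) s.2.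

Hypothesis N_flip : forall s, s \in N -> flip s \in N.
Hypothesis N_proper : forall s, s \in N -> ~~ (s.1 \subset s.2).

Lemma node_sub (x : node) s : s \in val x -> s \in N.
Proof. by case/and3P: (valP x) => /subsetP + _ _; apply. Qed.

Lemma node_flip (x : node) s : s \in N -> (flip s \in val x) = (s \notin val x).
Proof. by case/and3P: (valP x) => _ /forall_inP + _ => h /h/eqP. Qed.

Lemma node_le (x : node) s r :
  s \in N -> sep_le s r -> r \in val x -> s \in val x.
Proof.
case/and3P: (valP x) => _ _ /forall_inP h /h/forall_inP + sr rx.
by move=> /(_ _ rx)/implyP; apply.
Qed.

Lemma node_adjP (x y : node) :
  reflect (exists2 s, s \in N & val x :\: val y = [set s]) (node_adj x y).
Proof.
apply: (iffP cards1P) => [[s eqs]|[s _ eqs]]; last by exists s.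
exists s => //; apply: (@node_sub x).
by have := set11 s; rewrite -eqs in_setD => /andP[].
Qed.

Lemma node_diff_flip (x y : node) s :
  s \in N -> (flip s \in val y :\: val x) = (s \in val x :\: val y).
Proof. by move=> sN; rewrite !in_setD !node_flip // negbK andbC. Qed.

Lemma node_adj_sym : symmetric node_adj.
Proof.
suff adjC x y : node_adj x y -> node_adj y x.
  by move=> x y; apply/idP/idP; apply: adjC.
case/node_adjP=> s sN eqs; apply/node_adjP; exists (flip s); first exact: N_flip.
apply/setP => r; rewrite in_set1 -[r]flipK (inj_eq (inv_inj (@flipK V))).
case rN: (flip r \in N); first by rewrite node_diff_flip // eqs in_set1.
case: eqP => [rs|_]; first by rewrite rs sN in rN.
apply/negbTE; apply: contraFN rN; rewrite flipK => /setDP[/node_sub rN _].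
exact: N_flip.
Qed.

Lemma node_adj_simple : simple_graph node_adj.
Proof. by split; [exact: node_adj_sym | move=> x; rewrite /node_adj setDv cards0]. Qed.

Lemma node_adj_diff (x y : node) s r :
  node_adj x y -> s \in val x -> s \notin val y ->
  r \in val x -> r \notin val y -> r = s.
Proof.
case/node_adjP=> t _ /setP eqt sx sy rx ry.
have:= eqt s; have := eqt r; rewrite !in_setD !in_set1 sx sy rx ry /=.
by move=> /esym/eqP-> /esym/eqP->.
Qed.

(** Induction on the number of separations that [x] and [y] orient differently: one flip leads from
    [x] to a neighbour [x'] that disagrees with [y] on one separation fewer. *)
Lemma node_connect (x y : node) : connect node_adj x y.
Proof.
have [n] := ubnP #|val x :\: val y|; elim: n x => // n IHn x.
have [xy _|/set0Pn[s0 s0xy]] := eqVneq (val x :\: val y) set0.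
  suff -> : x = y by apply: connect0.
  apply/val_inj/setP=> r; apply/idP/idP => rx.
    by apply: contraTT rx => ry; have /setP/(_ r) := xy; rewrite !inE ry => /= ->.
  apply: contraTT rx => rx; have [rN|] := boolP (r \in N); last first.
    by apply: contraNN; apply: node_sub.
  by have /setP/(_ (flip r)) := xy; rewrite !inE !node_flip // rx andbT negbK => ->.
(* Flipping a maximal element of the difference gives an orientation. *)
case: (arg_maxnP (fun s : {set V} * {set V} => #|s.1| + #|~: s.2|) s0xy).
move=> s /= sxy smax ltn.
have [sy sx] : s \notin val y /\ s \in val x by move/setDP: sxy => [].
have sN := node_sub sx.
have fsy : flip s \in val y by rewrite node_flip.
have sfs : (s == flip s) = false by apply: contraTF fsy => /eqP <-.
(* The weight [#|s.1| + #|~: s.2|] grows strictly along [sep_le], so its maximiser [s] is a maximal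
   element of the difference. *)
have maxs r : r \in val x -> r \notin val y -> sep_le s r -> r = s.
  move=> rx ry /andP[sr1 sr2].
  have rxy : r \in val x :\: val y by rewrite in_setD rx ry.
  have /= rs := smax r rxy.
  have le1 := subset_leq_card sr1.
  have le2 : #|~: s.2| <= #|~: r.2| by rewrite subset_leq_card // setCS.
  have eq1 : s.1 = r.1 by apply/eqP; rewrite eqEcard sr1
    -(leq_add2r #|~: r.2|) (leq_trans rs) // leq_add2l.
  have eq2 : ~: s.2 = ~: r.2 by apply/eqP; rewrite eqEcard setCS sr2
    -(leq_add2l #|r.1|) (leq_trans rs) // leq_add2r.
  by move: eq1 (setC_inj eq2); case: (s) (r) => [? ?] [? ?] /= -> ->.
have ox' : orientation (flip s |: (val x :\ s)).
  apply/and3P; split.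
  - by rewrite subUset sub1set N_flip //= subDset subsetU //; apply/orP; right;
      apply/subsetP => r /node_sub.
  - apply/forall_inP => r rN; rewrite !inE node_flip // (inj_eq (inv_inj (@flipK V))).
    rewrite (can2_eq (@flipK V) (@flipK V)).
    have [->|rs] := eqVneq r s; first by rewrite sfs.
    have [->|rfs] := eqVneq r (flip s); first by [].
    by [].
  (* Downward closure. If [r] lies below [flip s] but outside [x], then [flip r] is in the
     difference and above [s], so [flip r = s]. If [s] lies below another member [t] of [x], then
     [t] is in the difference too, so [t = s]. *)
  apply/forall_inP => r rN; apply/forall_inP => t; rewrite !inE => ht.
  apply/implyP => rt; case/orP: ht => [/eqP et|/andP[ts tx]].
    have ry : r \in val y by apply: node_le rN rt _; rewrite et.
    have rs : r != s by apply: contraTneq ry => ->.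
    rewrite rs /=; apply/norP => -[rfs rx].
    have frx : flip r \in val x by rewrite node_flip.
    have := @maxs _ frx; rewrite node_flip // negbK => /(_ ry).
    by rewrite sep_le_flipr -et => /(_ rt) frs; rewrite -frs flipK eqxx in rfs.
  have rx := node_le rN rt tx; rewrite rx andbT; apply/orP; right.
  apply: contra_neqN ts => /eqP rs; rewrite rs in rt.
  apply: maxs => //; apply/negP => ty; case/negP: sy.
  exact: node_le sN rt ty.
pose x' : node := Sub _ ox'.
have xx' : val x :\: val x' = [set s].
  rewrite SubK; apply/setP=> r; rewrite !inE.
  have [->|rs] := eqVneq r s; first by rewrite sx sfs.
  by case: (r \in val x); rewrite ?orbT ?andbF.
apply: (@connect_trans _ _ x'); first by apply/connect1/node_adjP; exists s.
apply: IHn; rewrite ltnS in ltn; apply: leq_trans ltn; apply: proper_card.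
apply/properP; split; last by exists s => //; rewrite SubK !inE eqxx /= sfs !andbF.
apply/subsetP => r; rewrite SubK !inE => /andP[ry /orP[/eqP rs|/andP[_ ->]]].
  by rewrite rs fsy in ry.
by rewrite ry.
Qed.

(** Separations whose first side does not contain [K] are forced to point to their second side.
    These choices are consistent, and a maximal consistent partial orientation extending them
    decides every separation. *)
Lemma node_exists (K : {set V}) :
  (forall s, s \in N -> (K \subset s.1) || (K \subset s.2)) ->
  exists x : node, K \subset node_part x.
Proof.
move=> N_K.
pose partial o := [&& o \subset N, [forall s in N, (s \in o) ==> (flip s \notin o)]
   & [forall s in N, forall r in o, sep_le s r ==> (s \in o)]].
pose F := [set s in N | ~~ (K \subset s.1)].
have pF : partial F.
  apply/and3P; split.
  - by apply/subsetP => s; rewrite inE => /andP[].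
  - apply/forall_inP => s sN; rewrite !inE N_flip // sN /= negbK.
    by case/orP: (N_K s sN) => ->; rewrite ?implybT.
  apply/forall_inP => s sN; apply/forall_inP => r; rewrite !inE => /andP[_ Kr].
  apply/implyP => /andP[sr _]; rewrite sN /=; apply: contra Kr => Ks.
  exact: subset_trans Ks sr.
have [M /maxsetP[pM Mmax] FM] := maxset_exists pF.
case/and3P: (pM) => /subsetP MN /forall_inP Mflip /forall_inP Mle.
have {}Mle s r : s \in N -> r \in M -> sep_le s r -> s \in M.
  by move=> sN rM sr; have /forall_inP/(_ r rM)/implyP := Mle s sN; apply.
have {}Mflip s : s \in M -> flip s \notin M.
  by move=> sM; have /implyP/(_ sM) := Mflip s (MN s sM).
have oM : orientation M.
  apply/and3P; split.
  - exact/subsetP.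
  - apply/forall_inP => s sN; have [sM|sM] := boolP (s \in M).
      by rewrite (negbTE (Mflip s sM)).
    apply/eqP; apply: contraNT sM => fsM.
    (* If [M] contained neither [s] nor [flip s], adding [s] and everything below it would stay
       consistent, against maximality. *)
    pose M' := M :|: [set r in N | sep_le r s].
    suff pM' : partial M'.
      by rewrite -(Mmax M' pM' (subsetUl _ _)) !inE sN /sep_le !subxx orbT.
    apply/and3P; split.
    - rewrite subUset; apply/andP; split; apply/subsetP => r;
        [exact: MN | by rewrite inE => /andP[]].
    - apply/forall_inP => r rN; rewrite !inE N_flip // rN /=; apply/implyP.
      case/orP=> [rM|rs]; apply/norP; split.
      + exact: Mflip.
      + apply: contra fsM => frs.
        by apply: (Mle _ r) => //; [apply: N_flip | rewrite sep_le_flipl].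
      + apply: contra fsM => frM; apply: (Mle _ _ _ frM); first exact: N_flip.
        by rewrite sep_le_flip.
      (* Now [flip s] is below [r] and [r] is below [s], so [s.2] would be a subset of [s.1]. *)
      rewrite sep_le_flipl; apply/negP => fsr.
      have /andP[/= s21 _] := sep_le_trans fsr rs.
      by have := N_proper (N_flip sN); rewrite s21.
    apply/forall_inP => r rN; apply/forall_inP => t tM'; apply/implyP => rt.
    move: tM'; rewrite !inE rN /= => /orP[tM|/andP[_ ts]].
      by rewrite (Mle _ _ rN tM rt).
    by rewrite (sep_le_trans rt ts) orbT.
  apply/forall_inP => s sN; apply/forall_inP => r rM; apply/implyP; exact: Mle.
exists (Sub M oM); apply/bigcapsP => s; rewrite SubK => sM.
apply: contraTT (Mflip s sM) => Ks; rewrite negbK.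
by apply: (subsetP FM); rewrite inE N_flip //= MN.
Qed.

Lemma sep_act_orientation (a : {perm V}) (x : node) :
  (forall s, (sep_act a s \in N) = (s \in N)) ->
  orientation [set sep_act a s | s in val x].
Proof.
move=> aN; set o := [set _ | _ in _].
have ao s : (sep_act a s \in o) = (s \in val x) by rewrite mem_imset //; exact: sep_act_inj.
have NE s : s \in N -> exists2 r, r \in N & s = sep_act a r.
  have sE : s = sep_act a (sep_act a^-1 s).
    by case: s => A B; rewrite /sep_act /= !imset_permKV.
  by move=> sN; exists (sep_act a^-1 s) => //; rewrite -aN -sE.
apply/and3P; split.
- by apply/subsetP => s /imsetP[r /node_sub rN ->]; rewrite aN.
- apply/forall_inP => s /NE[r rN ->]; rewrite -sep_act_flip !ao node_flip //.
apply/forall_inP => s /NE[r rN ->]; apply/forall_inP => t /imsetP[t' t'x ->].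
by apply/implyP; rewrite sep_act_le ao => /node_le; apply.
Qed.

(** Nodes, adjacency and parts are defined from [N] without any choice, so a permutation of [V] that
    preserves [N] acts on all of them. *)
Lemma canonical_node (e : rel V) :
  (forall (a : {perm V}) s, automorphism e a -> (sep_act a s \in N) = (s \in N)) ->
  canonical_td e node_adj node_part.
Proof.
move=> N_act a ea.
pose g (x : node) : node :=
  Sub _ (sep_act_orientation x (fun s => N_act a s ea)).
have g_inj : injective g.
  move=> x y /(congr1 val); rewrite !SubK => /(imset_inj (@sep_act_inj V a)).
  exact: val_inj.
exists (perm g_inj) => [x y|x].
  rewrite !permE /node_adj !SubK -imset_setD; last exact: sep_act_inj.
  by rewrite card_imset //; exact: sep_act_inj.
rewrite permE; apply/setP => z; rewrite -[z](permKV a) mem_imset; last exact: perm_inj.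
apply/bigcapP/bigcapP => [zx s|zx s sx].
  by rewrite SubK => /imsetP[r rx ->]; rewrite mem_imset ?zx //; exact: perm_inj.
have := zx (sep_act a s); rewrite SubK mem_imset; last exact: sep_act_inj.
by move=> /(_ sx); rewrite /= mem_imset //; exact: perm_inj.
Qed.

(** * Nestedness makes the graph of nodes a tree *)

Hypothesis N_nested : forall s r, s \in N -> r \in N ->
  [|| sep_le s r, sep_le s (flip r), sep_le (flip s) r | sep_le (flip s) (flip r)].

(* For [r <> s] in [N], nestedness forces the orientation of [r] on the two
   ends of an edge that flips [s]. *)
Lemma node_adj_uniq (x x' y y' : node) s :
  node_adj x x' -> s \in val x -> s \notin val x' ->
  node_adj y y' -> s \in val y -> s \notin val y' -> x = y.
Proof.
have sub (u u' v v' : node) : node_adj u u' -> s \in val u -> s \notin val u' ->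
    node_adj v v' -> s \in val v -> s \notin val v' -> val u \subset val v.
  move=> uu su su' vv sv sv'; apply/subsetP => r ru.
  have [-> //|rs] := eqVneq r s.
  have [sN rN] := (node_sub su, node_sub ru).
  have ru' : r \in val u'.
    by apply: contraNT rs => ru'; apply/eqP; apply: node_adj_diff uu _ _ _ _.
  case/or4P: (N_nested sN rN).
  - by move=> sr; rewrite (node_le sN sr ru') in su'.
  - rewrite sep_le_flipr => rs'.
    have rv' : r \in val v' by apply: (node_le rN rs'); rewrite node_flip.
    apply: contraTT ru => rv; have frs : flip r = s.
      by apply: node_adj_diff vv _ _ _ _; rewrite ?node_flip ?rv' //.
    by rewrite -[r]flipK frs node_flip // su.
  - rewrite sep_le_flipl => frs.
    by have := node_le (N_flip rN) frs su; rewrite node_flip // ru.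
  by rewrite sep_le_flip => /(node_le rN); apply.
move=> xx sx sx' yy sy sy'; apply/val_inj/eqP; rewrite eqEsubset.
by rewrite (sub x x' y y') // (sub y y' x x').
Qed.

(** The far ends agree because the reversed edges flip [flip s]. Hence each separation is flipped
    along at most one edge. *)
Lemma node_adj_uniq2 (x x' y y' : node) s :
  node_adj x x' -> s \in val x -> s \notin val x' ->
  node_adj y y' -> s \in val y -> s \notin val y' -> x = y /\ x' = y'.
Proof.
move=> xx sx sx' yy sy sy'; split; first exact: node_adj_uniq xx sx sx' yy sy sy'.
have sN := node_sub sx.
apply: (@node_adj_uniq x' x y' y (flip s)); rewrite ?node_flip ?negbK //.
  by rewrite node_adj_sym.
by rewrite node_adj_sym.
Qed.

Lemma node_crossing (x : node) p s :
  path node_adj x p -> s \notin val x -> s \in val (last x p) ->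
  exists a b : node, [/\ a \in x :: p, b \in p, node_adj b a,
                      s \notin val a & s \in val b].
Proof.
elim: p x => [x _ /negbTE-> //|y p IHp x /= /andP[xy yp] sx sl].
have [sy|sy] := boolP (s \in val y).
  by exists x, y; rewrite node_adj_sym xy sx sy !mem_head.
have [a [b [ain bin ba sa sb]]] := IHp y yp sy sl.
by exists a, b; split; rewrite // in_cons ?ain ?bin orbT.
Qed.

(** If the edge from [x] to [y] flips [s], the rest of the cycle has to flip [s] back. Only the same
    edge can do so, and the cycle would revisit one of its ends. *)
Lemma node_acyclic (c : seq node) : ucycle node_adj c -> size c <= 2.
Proof.
case: c => [|x [|y [|z c]]] //= /andP[/= /and3P[xy yz zx] /and3P[xU yU _]].
case: (node_adjP _ _ xy) => s sN /setP/(_ s); rewrite !inE eqxx => /andP[sy sx].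
have [sz|sz] := boolP (s \in val z).
  have [xz _] := node_adj_uniq2 xy sx sy (etrans (node_adj_sym _ _) yz) sz sy.
  by rewrite xz !inE eqxx orbT in xU.
have := node_crossing zx sz; rewrite last_rcons => /(_ sx).
case=> a [b [ain _ ba sa sb]].
have [_ ya] := node_adj_uniq2 xy sx sy ba sb sa.
move: ain yU xU; rewrite -ya !inE mem_rcons !inE.
by case/or3P => [/eqP->|/eqP->|->]; rewrite ?eqxx ?orbT.
Qed.

(** A separation in [t2] but in neither [t1] nor [t3] would be flipped before [t2] and flipped back
    after it, on the same edge, so the path would repeat a node. *)
Lemma node_part_path (t1 t2 t3 : node) p :
  xy_path node_adj t1 t3 p -> t2 \in t1 :: p ->
  node_part t1 :&: node_part t3 \subset node_part t2.
Proof.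
move=> [t1p Up lp] t2p; move: t1p Up lp; case/splitPl: t2p => p1 p2 lp1.
rewrite cat_path last_cat lp1 => /andP[t1p1 t2p2] Up lp2.
apply/subsetP => v /setIP[/bigcapP v1 /bigcapP v3]; apply/bigcapP => s s2.
have [/v1//|s1] := boolP (s \in val t1).
have [/v3//|s3] := boolP (s \in val t3).
have sN := node_sub s2.
have := node_crossing t1p1 s1; rewrite lp1 => /(_ s2) [a [b [ain _ ba sa sb]]].
have := @node_crossing t2 p2 (flip s) t2p2.
rewrite lp2 !node_flip // s2 s3 => /(_ isT isT) [c [d [_ din dc]]].
rewrite !node_flip // negbK => sc sd.
have [_ ad] := node_adj_uniq2 ba sb sa (etrans (node_adj_sym _ _) dc) sc sd.
move: Up; rewrite -cat_cons cat_uniq => /and3P[_ /hasPn/(_ d din)].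
by rewrite -ad /= ain.
Qed.

(** No separation in [N] splits the empty set, a vertex or an edge, so [node_exists] yields a node,
    and a part around each vertex and each edge. *)
Lemma nested_tree_decomposition (e : rel V) :
  (forall s, s \in N -> s.1 :|: s.2 = setT) ->
  (forall s, s \in N -> forall x y, x \notin s.2 -> y \notin s.1 -> ~~ e x y) ->
  tree_decomposition e node_adj node_part.
Proof.
move=> N_cover N_edge; split.
- split; [exact: node_adj_simple | | exact: node_connect | exact: node_acyclic].
  have [x _] := @node_exists set0 (fun s _ => introT orP (or_introl (sub0set _))).
  by apply/card_gt0P; exists x.
- move=> x; have [s sN|t] := @node_exists [set x].
    by rewrite !sub1set -in_setU N_cover ?inE.
  by rewrite sub1set; exists t.
- move=> x y xy; have [s sN|t] := @node_exists [set x; y].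
    have := N_edge _ sN x y; have := N_edge _ (N_flip sN) x y.
    have := in_setT x; rewrite -(N_cover s sN) !subUset !sub1set !inE /=.
    have := in_setT y; rewrite -(N_cover s sN) !inE xy /=.
    case: (x \in s.1) (x \in s.2) (y \in s.1) (y \in s.2) => [] [] [] [] //= _ _ h1 h2;
      by [have := h1 isT isT | have := h2 isT isT].
  by rewrite subUset !sub1set => /andP[]; exists t.
exact: node_part_path.
Qed.

(** The tree edge flips some [s], so one of the two parts lies in [s.2] and the other in [s.1]. *)
Lemma node_adhesion k :
  (forall s, s \in N -> #|s.1 :&: s.2| < k) -> adhesion_lt node_adj node_part k.
Proof.
move=> N_order x y /node_adjP[s sN /setP/(_ s)]; rewrite !inE eqxx => /andP[sy sx].
apply: leq_ltn_trans (N_order s sN); rewrite setIC; apply: subset_leq_card.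
apply: setISS; last exact: bigcap_inf.
by apply: (bigcap_inf (flip s)); rewrite node_flip.
Qed.

End TreeOfNestedSystem.

(** * Separations, components and k-blocks *)

Lemma connect_ind_pred (T : finType) (r : rel T) (P : pred T) x y :
  (forall u w, r u w -> P u -> P w) -> connect r x y -> P x -> P y.
Proof.
move=> rP /connectP[p + ->]; elim: p x => //= z p IHp x /andP[xz zp] Px.
exact/IHp/rP/Px.
Qed.

Section Separations.

Variables (V : finType) (e : rel V).
Hypothesis e_sym : symmetric e.
Hypothesis e_irr : irreflexive e.
Implicit Types (A B C D X Y S : {set V}) (x y u v w : V).

Definition separation A B :=
  (A :|: B == setT) && [forall x, forall y, (x \notin B) && (y \notin A) ==> ~~ e x y].

Lemma separationP A B :
  reflect (A :|: B = setT /\ forall x y, x \notin B -> y \notin A -> ~~ e x y)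
          (separation A B).
Proof.
apply: (iffP andP) => [[/eqP AB /forallP eAB]|[-> eAB]]; split=> //.
  by move=> x y xB yA; have /forallP/(_ y) := eAB x; rewrite xB yA.
by apply/forallP => x; apply/forallP => y; apply/implyP => /andP[]; exact: eAB.
Qed.

Lemma separationC A B : separation A B -> separation B A.
Proof.
case/separationP => AB eAB; apply/separationP; split; first by rewrite setUC.
by move=> x y xA yB; rewrite e_sym eAB.
Qed.

Lemma separation_or A B x : separation A B -> x \notin A -> x \in B.
Proof.
by case/separationP => AB _; have := in_setT x; rewrite -AB inE => /orP[->|].
Qed.

Lemma separation_edge A B x y : separation A B -> x \notin A -> e x y -> y \in B.
Proof.
move=> /separationC/separationP[_ eBA] xA; apply: contraTT => yB; exact: eBA.
Qed.

Lemma separation_meet A B C D :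
  separation A B -> separation C D -> separation (A :&: C) (B :|: D).
Proof.
move=> sAB sCD; apply/separationP; split=> [|x y].
  apply/setP => x; rewrite !inE.
  have [xA|/(separation_or sAB)->] := boolP (x \in A); last by rewrite orbT.
  by have [xC|/(separation_or sCD)->] := boolP (x \in C); rewrite ?orbT.
rewrite !inE => /norP[xB xD]; apply: contraNN => xy.
by rewrite (separation_edge (separationC sAB) xB xy) (separation_edge (separationC sCD) xD xy).
Qed.

(** Submodularity: the union and the intersection of the two corner separators lie in those of
    [A :&: B] and [C :&: D]. *)
Lemma separation_order_submod A B C D :
  #|(A :&: C) :&: (B :|: D)| + #|(B :&: D) :&: (A :|: C)| <=
  #|A :&: B| + #|C :&: D|.
Proof.
rewrite -cardsUI -[leqRHS]cardsUI; apply: leq_add; apply/subset_leq_card/subsetP => x;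
  by rewrite !inE; case: (x \in A) (x \in B) (x \in C) (x \in D) => [] [] [] [].
Qed.

Lemma separation_separates A B x y :
  separation A B -> x \notin A -> y \notin B -> separates_pair e (A :&: B) x y.
Proof.
move=> sAB xA yB; rewrite /separates_pair !inE (negbTE xA) (negbTE yB) andbF /=.
apply: contraL yB => xy.
suff : y \notin A by move=> /(separation_or sAB) ->.
apply: (connect_ind_pred (P := fun z => z \notin A) _ xy) => // u w.
move=> /and3P[_ wAB uw] uA; apply: contra wAB => wA.
by rewrite inE wA (separation_edge sAB uA uw).
Qed.

Lemma inseparable_side k X A B :
  inseparable e k X -> separation A B -> #|A :&: B| < k ->
  (X \subset A) || (X \subset B).
Proof.
move=> iX sAB ltk; apply/orP.
have [|/subsetPn[x xX xA]] := boolP (X \subset A); first by left.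
have [|/subsetPn[y yX yB]] := boolP (X \subset B); first by right.
have /forall_inP/(_ x xX)/forall_inP/(_ y yX)/forallP/(_ (A :&: B)) := iX.
rewrite ltk (separation_separates sAB xA yB) andbT implybF negbK => /eqP xy.
by rewrite -xy (separation_or sAB xA) in yB.
Qed.

Lemma separation_order n A B x y :
  n_connected e n -> separation A B -> x \notin A -> y \notin B -> n <= #|A :&: B|.
Proof.
move=> [_ conn] sAB xA yB; rewrite leqNgt; apply/negP => /conn /existsP; apply.
by exists x; apply/existsP; exists y; apply: separation_separates.
Qed.

(** For [v] outside [X] this is a component of G - X; for [v] in [X] it degenerates to the singleton
    of [v]. *)
Definition comp X v := [set u | connect (del_verts e X) v u].

Definition nbh C := [set u | (u \notin C) && [exists w in C, e w u]].

(** Connectedness in the form of an induction principle along edges inside [C]. *)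
Definition connected_set C := forall (P : {set V}) x,
  x \in C -> x \in P ->
  (forall u w, u \in C -> u \in P -> w \in C -> e u w -> w \in P) -> C \subset P.

Lemma del_verts_connect_sym S : connect_sym (del_verts e S).
Proof.
by apply: sym_connect_sym => x y; rewrite /del_verts /= e_sym; do 2!case: (_ \notin _).
Qed.

Lemma comp_refl X v : v \in comp X v.
Proof. by rewrite inE connect0. Qed.

Lemma comp_disjoint X v : v \notin X -> [disjoint comp X v & X].
Proof.
move=> vX; rewrite disjoint_subset; apply/subsetP => u; rewrite !inE => vu.
by apply: (connect_ind_pred (P := fun z => z \notin X) _ vu) => // a b /= /and3P[].
Qed.

Lemma comp_notin X v u : v \notin X -> u \in comp X v -> u \notin X.
Proof. by move=> /comp_disjoint/pred0P/(_ u) /=; case: (u \in comp X v) => //= ->. Qed.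

Lemma comp_edge X v u w :
  v \notin X -> u \in comp X v -> e u w -> w \notin X -> w \in comp X v.
Proof.
move=> vX uC uw wX; have uX := comp_notin vX uC.
move: uC; rewrite !inE => vu; apply: connect_trans vu (connect1 _).
by rewrite /del_verts /= uX wX.
Qed.

Lemma nbh_comp X v : v \notin X -> nbh (comp X v) \subset X.
Proof.
move=> vX; apply/subsetP => u; rewrite inE => /andP[+ /exists_inP[w wC wu]].
by apply: contraNT; apply: comp_edge wu.
Qed.

Lemma comp_connected X v : v \notin X -> connected_set (comp X v).
Proof.
move=> vX P x xC xP closed; apply/subsetP => y yC.
have xy : connect (del_verts e X) x y.
  by move: xC yC; rewrite !inE del_verts_connect_sym; apply: connect_trans.
suff /setIP[] : y \in comp X v :&: P by [].
apply: (connect_ind_pred (P := mem (comp X v :&: P)) _ xy); last exact/setIP.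
move=> u w /and3P[uX wX uw] /setIP[uC uP]; apply/setIP.
have wC := comp_edge vX uC uw wX.
by split=> //; apply: closed uC uP wC uw.
Qed.

Lemma nbh_separation C : separation (C :|: nbh C) (~: C).
Proof.
apply/separationP; split=> [|x y].
  by apply/setP => x; rewrite !inE; case: (x \in C); rewrite ?orbT.
rewrite !inE negbK => xC /norP[yC]; rewrite yC /=; apply: contra => xy.
by apply/exists_inP; exists x.
Qed.

Lemma nbh_order C : (C :|: nbh C) :&: ~: C = nbh C.
Proof. by apply/setP => x; rewrite !inE; case: (x \in C); rewrite ?andbT. Qed.

(** * Blocks and the paths that cross a separator *)

Lemma k_block_card k X : k_block e k X -> k <= #|X|.
Proof. by case/maxsetP => /andP[]. Qed.

Lemma k_block_inseparable k X : k_block e k X -> inseparable e k X.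
Proof. by case/maxsetP => /andP[]. Qed.

(** By maximality of [X], fewer than [k] vertices [S] separate [v] from some [x] in [X]. The
    component of [v] in G - S gives the separation, and [x] decides on which side [X] lies. *)
Lemma k_block_separation k X v :
  k_block e k X -> v \notin X ->
  exists A B, [/\ separation A B, #|A :&: B| < k, X \subset A & v \notin A].
Proof.
move=> bX vX.
have : ~~ inseparable e k (v |: X).
  apply: contra vX => iX; case/maxsetP: bX => /andP[kX _] maxX.
  rewrite -(maxX (v |: X)) ?setU11 ?subsetUr // iX andbT.
  exact: leq_trans kX (subset_leq_card (subsetUr _ _)).
have iX := k_block_inseparable bX.
suff sv x S : x \in X -> #|S| < k -> separates_pair e S v x ->
    exists A B, [/\ separation A B, #|A :&: B| < k, X \subset A & v \notin A].
  case/forall_inPn => x; rewrite inE => xvX /forall_inPn[y yvX /forallPn[S]].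
  rewrite negb_imply negbK => /andP[/andP[xy ltk] sS].
  have sSC : separates_pair e S y x.
    by rewrite /separates_pair andbCA del_verts_connect_sym; exact: sS.
  move: xvX yvX; rewrite !inE => /orP[/eqP xv|xX] /orP[/eqP yv|yX].
  - by rewrite xv yv eqxx in xy.
  - by apply: sv yX ltk _; rewrite -xv.
  - by apply: sv xX ltk _; rewrite -yv.
  have /forall_inP/(_ x xX)/forall_inP/(_ y yX)/forallP/(_ S) := iX.
  by rewrite xy ltk sS.
move=> xX ltk /and3P[vS xS vx].
have sAB : separation (~: comp S v) (comp S v :|: S).
  apply/separationC/separationP; split=> [|u w].
    by apply/setP => u; rewrite !in_setU in_setC in_setT; case: (u \in comp S v); rewrite ?orbT.
  rewrite in_setC negbK in_setU => uC /norP[wC wS]; apply: contra wC => uw.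
  exact: comp_edge uC uw wS.
have leS : #|~: comp S v :&: (comp S v :|: S)| < k.
  apply: leq_ltn_trans (subset_leq_card _) ltk; apply/subsetP => u.
  by rewrite in_setI in_setC in_setU => /andP[/negbTE->].
exists (~: comp S v), (comp S v :|: S); split=> //; last by rewrite in_setC comp_refl.
case/orP: (inseparable_side iX sAB leS) => // /subsetP/(_ x xX).
by rewrite in_setU (negbTE xS) inE (negbTE vx).
Qed.

(** Each path contributes an inner vertex in [S]; independence makes these distinct, and [x] and [y]
    account for the [+ 2]. *)
Lemma independent_paths_hit m x y S :
  independent_nonedge_paths e x y m -> x != y -> x \in S -> y \in S ->
  (forall p, xy_path e x y p -> p <> [:: y] ->
     exists z, [/\ z \in p, z != y & z \in S]) ->
  m + 2 <= #|S|.
Proof.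
move=> [P [_ Ppath Pind]] xy xS yS hit.
have hitP i : exists z, [&& z \in P i, z != y & z \in S].
  by case: (Ppath i) => pi ni; have [z [? ? ?]] := hit _ pi ni; exists z; apply/and3P.
pose g i := xchoose (hitP i).
have gP i : [/\ g i \in P i, g i != y & g i \in S] by apply/and3P/(xchooseP (hitP i)).
have gx i : g i != x.
  have [[_ /= /andP[xP _] _] _] := Ppath i; have [gi _ _] := gP i.
  by apply: contraNneq xP => <-.
have g_inj : injective g.
  move=> i j gij; apply/eqP/negPn/negP => ij.
  have [gi giy _] := gP i; have [gj _ _] := gP j; rewrite -gij in gj.
  have := Pind i j (g i) ij; rewrite !inE gi gj !orbT => /(_ isT isT).
  by case=> /eqP; apply/negP.
have : #|[set g i | i in 'I_m]| <= #|S :\ x :\ y|.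
  apply/subset_leq_card/subsetP => z /imsetP[i _ ->].
  by have [_ giy giS] := gP i; rewrite !inE giy gx giS.
rewrite card_imset // card_ord (cardsD1 x S) xS (cardsD1 y (S :\ x)) !inE eq_sym xy yS.
by rewrite /=; lia.
Qed.

(** The set [Q] is a trap: a path whose inner vertices avoid [S] stays in [Q], from which no edge
    leads to [y]. *)
Lemma path_hit x y p S (Q : {set V}) :
  xy_path e x y p -> x != y -> p <> [:: y] ->
  (forall u, e x u -> u \notin S -> u \in Q) ->
  (forall u w, u \in Q -> e u w -> w \notin S -> w \in Q) ->
  (forall u, u \in Q -> ~~ e u y) ->
  exists z, [/\ z \in p, z != y & z \in S].
Proof.
move=> [xp Up lp] xy py hx hQ hy.
suff /hasP[z zp /andP[zy zS]] : has (fun z => (z != y) && (z \in S)) p by exists z.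
apply/negPn/negP => /hasPn noS.
have {}noS z : z \in p -> z != y -> z \notin S.
  by move=> /noS; case: (z == y).
case: p xp Up lp py noS => [|z p] /= xp Up lp py noS; first by rewrite lp eqxx in xy.
case/andP: xp => xz zp; case/andP: Up => _.
have [zy|zy] := eqVneq z y.
  case: p lp zp py {noS} => [|w p] /= lp _ py; first by rewrite zy in py.
  by rewrite zy -lp mem_last.
move=> _; have zQ : z \in Q by apply: hx xz _; apply: noS; rewrite ?mem_head.
have {}noS w : w \in p -> w != y -> w \notin S.
  by move=> wp; apply: noS; rewrite inE wp orbT.
elim: p z zy zQ zp lp noS {xz py} => [z zy _ _ /= zE|w p IHp z zy zQ /= /andP[zw wp] lp noS].
  by rewrite zE eqxx in zy.
have [wy|wy] := eqVneq w y; first by have := hy z zQ; rewrite -wy zw.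
apply: IHp wp lp _ => //; first by apply: hQ zQ zw _; apply: noS wy; apply: mem_head.
by move=> t tp; apply: noS; rewrite inE tp orbT.
Qed.

Lemma comp_eq X u v : u \in comp X v -> comp X u = comp X v.
Proof.
rewrite inE => vu; apply/setP => w.
by rewrite !inE (same_connect (del_verts_connect_sym X) vu).
Qed.

(** As soon as [C] or its neighbourhood meets the component, edges outside [X] carry all of [C] into
    it. *)
Lemma connected_comp_or C X v :
  connected_set C -> [disjoint C & X] -> v \notin X ->
  (C \subset comp X v) || (C :|: nbh C \subset ~: comp X v).
Proof.
move=> conn /pred0P CX vX.
have CnX u : u \in C -> u \notin X by move=> uC; have /= := CX u; rewrite uC /= => ->.
have sub u : u \in C -> u \in comp X v -> C \subset comp X v.
  move=> uC uv; apply: (conn _ u) => // w t wC wv tC wt.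
  exact: comp_edge wv wt (CnX t tC).
case CC: (C \subset comp X v) => //=; apply/subsetP => u; rewrite in_setU in_setC.
case/orP => [uC|]; first by apply: contraFN CC; apply: sub.
rewrite inE => /andP[_ /exists_inP[w wC wu]]; apply: contraFN CC => uv.
by apply: (sub w wC); apply: (comp_edge vX uv _ (CnX w wC)); rewrite e_sym.
Qed.

Lemma connected_eq_nbh C D z :
  connected_set C -> nbh C = nbh D -> z \in C -> z \in D -> C \subset D.
Proof.
move=> conn CD zC zD; apply: (conn _ z) => // u w uC uD wC uw.
apply/negPn/negP => wD; have : w \in nbh D.
  by rewrite inE wD; apply/exists_inP; exists u.
by rewrite -CD inE wC.
Qed.

(** Oriented so that an orientation containing it points away from [C]. *)
Definition nbh_sep C := (C :|: nbh C, ~: C).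

Lemma nbh_sep_le C D : C \subset D -> sep_le (nbh_sep C) (nbh_sep D).
Proof.
move=> CD; rewrite /sep_le /= setCS CD andbT; apply/subsetP => u.
rewrite !inE => /orP[/(subsetP CD)->//|/andP[_ /exists_inP[w wC wu]]].
by case: (u \in D) => //=; apply/exists_inP; exists w => //; apply: (subsetP CD).
Qed.

Lemma nbh_sep_disjoint C D :
  C :|: nbh C \subset ~: D -> sep_le (nbh_sep C) (flip (nbh_sep D)).
Proof.
move=> CD; rewrite /sep_le /= CD /=; apply/subsetP => u; rewrite in_setC.
apply: contraTN => uC; rewrite in_setU negb_or; apply/andP; split.
  by have := subsetP CD u; rewrite !inE uC; apply.
rewrite inE negb_and; apply/orP; right; apply/exists_inPn => w wD.
apply/negP => wu; suff wCN : w \in C :|: nbh C.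
  by have := subsetP CD w wCN; rewrite in_setC wD.
rewrite !inE; case: (w \in C) => //=.
by apply/exists_inP; exists u; rewrite // e_sym.
Qed.

(** * The separations given by the k-blocks *)

Definition block_comps k : {set {set V}} :=
  [set C | [exists X : {set V}, exists v, [&& k_block e k X, v \notin X & C == comp X v]]].

Definition block_seps k :=
  [set s : {set V} * {set V} |
     [exists C in block_comps k, (s == nbh_sep C) || (s == flip (nbh_sep C))]].

Lemma block_compsP k C :
  reflect (exists X v, [/\ k_block e k X, v \notin X & C = comp X v])
          (C \in block_comps k).
Proof.
rewrite inE; apply: (iffP existsP) => [[X /existsP[v /and3P[? ? /eqP->]]]|[X [v [bX vX ->]]]].
  by exists X, v.
by exists X; apply/existsP; exists v; rewrite bX vX eqxx.
Qed.

Lemma block_sepsP k s :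
  reflect (exists2 C, C \in block_comps k & s = nbh_sep C \/ s = flip (nbh_sep C))
          (s \in block_seps k).
Proof.
rewrite inE; apply: (iffP exists_inP) => -[C CB sC]; exists C => //.
  by case/orP: sC => /eqP; [left|right].
by case: sC => ->; rewrite eqxx ?orbT.
Qed.

(** * Invariance under automorphisms *)

Section Automorphism.

Variable a : {perm V}.
Hypothesis e_a : automorphism e a.

Lemma automorphismV : automorphism e a^-1.
Proof. by move=> x y; rewrite -e_a !permKV. Qed.

Lemma nbh_imset C : a @: nbh C = nbh (a @: C).
Proof.
apply/setP => u; rewrite -[u](permKV a) !inE !mem_imset; try exact: perm_inj.
rewrite inE; congr andb; apply/exists_inP/exists_inP => -[w wC wu].
  by exists (a w); rewrite ?mem_imset ?e_a //; apply: perm_inj.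
by case/imsetP: wC wu => t tC -> tu; exists t; rewrite // -e_a.
Qed.

Lemma connect_imset S u v :
  connect (del_verts e S) u v -> connect (del_verts e (a @: S)) (a u) (a v).
Proof.
move=> uv; apply: (connect_ind_pred
  (P := fun z => connect (del_verts e (a @: S)) (a u) (a z)) _ uv) => // w z.
rewrite /del_verts /= => /and3P[wS zS wz] uw; apply: connect_trans uw (connect1 _).
by rewrite /= !mem_imset ?wS ?zS ?e_a //; apply: perm_inj.
Qed.

End Automorphism.

Lemma connect_imsetE a S u v : automorphism e a ->
  connect (del_verts e (a @: S)) (a u) (a v) = connect (del_verts e S) u v.
Proof.
move=> e_a; apply/idP/idP; last exact: connect_imset.
by move/(connect_imset (automorphismV e_a)); rewrite imset_permK !permK.
Qed.

Lemma inseparable_imset a k X :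
  automorphism e a -> inseparable e k X -> inseparable e k (a @: X).
Proof.
move=> e_a iX; apply/forall_inP => _ /imsetP[x xX ->].
apply/forall_inP => _ /imsetP[y yX ->]; apply/forallP => S.
rewrite -[S](imset_permKV a) card_imset; last exact: perm_inj.
rewrite (inj_eq perm_inj) /separates_pair !mem_imset; try exact: perm_inj.
rewrite connect_imsetE //.
by have /forall_inP/(_ x xX)/forall_inP/(_ y yX)/forallP/(_ (a^-1%g @: S)) := iX.
Qed.

Lemma k_block_imset a k X :
  automorphism e a -> k_block e k X -> k_block e k (a @: X).
Proof.
move=> e_a bX; have [/andP[kX iX] maxX] := maxsetP bX.
apply/maxsetP; split.
  by rewrite card_imset ?kX ?inseparable_imset //; apply: perm_inj.
move=> Y /andP[kY iY] aXY; suff <- : a^-1%g @: Y = X by rewrite imset_permKV.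
apply: maxX; last by rewrite -[X](imset_permK a) imsetS.
rewrite card_imset ?kY; last exact: perm_inj.
exact: inseparable_imset (automorphismV e_a) iY.
Qed.

Lemma comp_imset a X v : automorphism e a -> a @: comp X v = comp (a @: X) (a v).
Proof.
move=> e_a; apply/setP => u; rewrite -[u](permKV a) mem_imset; last exact: perm_inj.
by rewrite !inE connect_imsetE.
Qed.

Lemma sep_act_block_seps a k s :
  automorphism e a -> (sep_act a s \in block_seps k) = (s \in block_seps k).
Proof.
have sub b r : automorphism e b -> r \in block_seps k -> sep_act b r \in block_seps k.
  move=> e_b /block_sepsP[C /block_compsP[X [v [bX vX CE]]] rC].
  apply/block_sepsP; exists (b @: C).
    apply/block_compsP; exists (b @: X), (b v); rewrite CE comp_imset //.
    by rewrite k_block_imset // mem_imset //; apply: perm_inj.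
  have bC : b @: (~: C) = ~: (b @: C).
    apply/setP => u; rewrite -[u](permKV b) in_setC !mem_imset; try exact: perm_inj.
    by rewrite in_setC.
  have actC : sep_act b (nbh_sep C) = nbh_sep (b @: C).
    by rewrite /sep_act /= imsetU nbh_imset // bC.
  by case: rC => ->; rewrite ?sep_act_flip actC; [left|right].
move=> e_a; apply/idP/idP; last exact: sub.
move/(sub _ _ (automorphismV e_a)); case: s => A B.
by rewrite /sep_act /= !imset_permK.
Qed.

(** * Consequences of connectivity and of the conditions on adjacent vertices *)

Section AdjacencyConditions.

Variable k : nat.
Hypothesis k_gt0 : 0 < k.
Hypothesis e_conn : n_connected e (k - 1).
Hypothesis e_adj : forall x y, e x y ->
  [\/ k - 3 <= #|common_neighbours e x y|,
      independent_nonedge_paths e x y ((3 * (k - 2)) %/ 2)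
    | exists X, [/\ k_block e k X, x \in X & y \in X]].

(* If the corner of [A'] and [A] has order at least [k], then by submodularity
   the opposite corner has order less than [k - 1], so its interior is empty.
   An edge [xy] as below would have its common neighbours in [B :&: B'], any
   [k]-block containing it inside [B :&: B'], and its independent paths
   hitting both of the small sets [S] and [S']. *)
Lemma no_crossing_edge A B A' B' X x y :
  separation A B -> #|A :&: B| < k -> separation A' B' -> #|A' :&: B'| < k ->
  X \subset A -> k <= #|X| ->
  k <= #|(A :&: A') :&: (B :|: B')| ->
  x \notin A -> y \notin A' -> ~~ e x y.
Proof.
move=> sAB ltAB sAB' ltAB' XA kX kC xA yA'; apply/negP => xy.
have submod := separation_order_submod A B A' B'.
have /subsetPn[z zX zB] : ~~ (X \subset B).
  apply/negP => XB; have := subset_leq_card (introT subsetIP (conj XA XB)).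
  by rewrite leqNgt (leq_trans ltAB).
(* By submodularity the separation [(B :&: B', A :|: A')] has order at most k - 2. As [z] lies
   outside [B], a vertex outside [A :|: A'] would contradict (k-1)-connectedness. *)
have cover u : u \notin A -> u \in A'.
  move=> uA; apply/negPn/negP => uA'.
  have sU := separationC (separation_meet (separationC sAB) (separationC sAB')).
  have := separation_order e_conn sU.
  move=> /(_ u z); rewrite !inE (negbTE uA) (negbTE uA') (negbTE zB) => /(_ isT isT).
  by rewrite setIC; move: submod ltAB ltAB' kC k_gt0; clear; lia.
(* Since [A] and [A'] cover [V], the small corner separator is all of [B :&: B']. *)
have BB : #|B :&: B'| + 2 <= k.
  have <- : (B :&: B') :&: (A :|: A') = B :&: B'.
    apply/setIidPl/subsetP => u _; rewrite inE.
    by have [//|/cover->] := boolP (u \in A).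
  by move: submod ltAB ltAB' kC; clear; lia.
have yA : y \in A by apply: contraNT yA'; apply: cover.
have xA' := cover x xA.
have yB := separation_edge sAB xA xy.
have yx : e y x by rewrite e_sym.
have xB' := separation_edge sAB' yA' yx.
have xB := separation_or sAB xA.
have yB' := separation_or sAB' yA'.
have nxy : x != y by apply: contraTneq yA => <-.
case: (e_adj xy) => [common|indep|[Y [bY xY yY]]].
(* With [x] and [y], the k - 3 common neighbours would make [B :&: B'] have at least k - 1
   vertices. *)
- have : #|common_neighbours e x y| <= #|B :&: B' :\ x :\ y|.
    apply/subset_leq_card/subsetP => u; rewrite !inE => /andP[xu yu].
    rewrite (separation_edge sAB xA xu) (separation_edge sAB' yA' yu).
    have [uE|_] := eqVneq u y; first by rewrite uE e_irr in yu.
    by have [uE|//] := eqVneq u x; rewrite uE e_irr in xu.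
  have : #|B :&: B'| = 2 + #|B :&: B' :\ x :\ y|.
    by rewrite (cardsD1 x (B :&: B')) (cardsD1 y (B :&: B' :\ x)) !inE eq_sym nxy xB xB' yB yB'.
  by move: common BB; clear; lia.
(* Both sets contain [x] and [y] and meet every other path between them in an inner vertex: all
   neighbours of [x] are in [B] and all neighbours of [y] in [B']. *)
- pose S := B :&: (A :|: B'); pose S' := B' :&: (A' :|: B).
  have mS : (3 * (k - 2)) %/ 2 + 2 <= #|S|.
    apply: (independent_paths_hit indep nxy); rewrite ?inE ?xB ?xB' ?yB ?yA ?orbT //.
    move=> p pxy pE; apply: (path_hit (Q := ~: A :&: ~: B') pxy nxy pE).
    + by move=> u /(separation_edge sAB xA) uB; rewrite !inE uB negb_or.
    + move=> u w; rewrite !inE => /andP[uA _] /(separation_edge sAB uA) wB.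
      by rewrite wB negb_or.
    move=> u; rewrite !inE => /andP[_ uB']; apply: contra uB' => uy.
    by apply: (separation_edge sAB' yA'); rewrite e_sym.
  have mS' : (3 * (k - 2)) %/ 2 + 2 <= #|S'|.
    apply: (independent_paths_hit indep nxy); rewrite ?inE ?xB ?xB' ?yB ?yB' ?orbT //.
    move=> p pxy pE; apply: (path_hit (Q := ~: B') pxy nxy pE).
    + by move=> u /(separation_edge sAB xA) uB; rewrite !inE uB orbT andbT.
    + move=> u w; rewrite !inE => uB' /(separation_edge (separationC sAB') uB') wA'.
      by rewrite wA' andbT.
    move=> u; rewrite !inE => uB'; apply: contra uB' => uy.
    by apply: (separation_edge sAB' yA'); rewrite e_sym.
  have cS : #|S| <= #|A :&: B| + #|B :&: B' :\: A|.
    apply: leq_trans (leq_card_setU _ _); apply/subset_leq_card/subsetP => u.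
    by rewrite !inE; case: (u \in A) (u \in B) => [] [].
  have cS' : #|S'| <= #|A' :&: B'| + #|B :&: B' :\: A'|.
    apply: leq_trans (leq_card_setU _ _); apply/subset_leq_card/subsetP => u.
    by rewrite !inE; case: (u \in A') (u \in B) (u \in B') => [] [] [].
  have : #|B :&: B' :\: A| + #|B :&: B' :\: A'| <= #|B :&: B'|.
    rewrite -cardsUI [X in _ + X](_ : _ = 0) ?addn0.
      by apply/subset_leq_card/subsetP => u; rewrite !inE => /orP[] /andP[].
    apply/eqP; rewrite cards_eq0; apply/eqP/setP => u; rewrite !inE.
    by have [//|/cover->] := boolP (u \in A); rewrite /= ?andbF.
  (* With m the number of paths, the bounds add up to 2m + 4 <= 2(k - 1) + (k - 2) = 3k - 4, whereas
     rounding down gives 2m >= 3(k - 2) - 1 = 3k - 7. *)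
  have mod2 : (3 * (k - 2)) %% 2 < 2 by rewrite ltn_mod.
  move: mS mS' cS cS' ltAB ltAB' BB mod2 (divn_eq (3 * (k - 2)) 2).
  by clear; move: (_ %/ _) (_ %% _) => q r; lia.
have iY := k_block_inseparable bY.
have YB : Y \subset B.
  by have /orP[/subsetP/(_ x xY)|//] := inseparable_side iY sAB ltAB; rewrite (negbTE xA).
have YB' : Y \subset B'.
  by have /orP[/subsetP/(_ y yY)|//] := inseparable_side iY sAB' ltAB'; rewrite (negbTE yA').
have := leq_trans (k_block_card bY) (subset_leq_card (introT subsetIP (conj YB YB'))).
by move: BB; clear; lia.
Qed.

Lemma nbh_block_comp_lt X v :
  k_block e k X -> v \notin X -> #|nbh (comp X v)| < k.
Proof.
move=> bX vX; set C := comp X v; have kX := k_block_card bX.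
pose P (s : {set V} * {set V}) :=
  [&& separation s.1 s.2, #|s.1 :&: s.2| < k & X \subset s.1].
have [A0 [B0 [sAB0 ltAB0 XA0 vA0]]] := k_block_separation bX vX.
have P0 : P (A0, B0) by apply/and3P.
case: (arg_maxnP (fun s : {set V} * {set V} => #|C :\: s.1|) P0) => -[A B].
case/and3P => /= sAB ltAB XA maxA.
have [z zC zA] : exists2 z, z \in C & z \notin A.
  have /card_gt0P[z] : 0 < #|C :\: A|.
    apply: leq_trans (maxA _ P0); apply/card_gt0P; exists v.
    by rewrite inE vA0 comp_refl.
  by rewrite inE => /andP[zA zC]; exists z.
(* If all of [C] is cut off, its neighbourhood lies in [X], hence in [A], and also in [B], being
   adjacent to vertices outside [A]. *)
have [CA|/subsetPn CA] := boolP (C \subset ~: A).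
  apply: leq_ltn_trans ltAB; apply/subset_leq_card/subsetP => u uN.
  rewrite inE (subsetP XA) ?(subsetP (nbh_comp vX)) //=.
  move: uN; rewrite inE => /andP[_ /exists_inP[w wC wu]].
  by apply: separation_edge sAB _ wu; have := subsetP CA w wC; rewrite inE.
exfalso; case: CA => t tC tA.
suff /subsetP/(_ t tC) : C \subset ~: A by move/negP: tA.
apply: (comp_connected vX zC); first by rewrite inE.
move=> x y xC; rewrite !in_setC => xA yC; apply: contraTN => yA.
have yX := comp_notin vX yC.
have [A' [B' [sAB' ltAB' XA' yA']]] := k_block_separation bX yX.
apply: (no_crossing_edge sAB ltAB sAB' ltAB' XA kX _ xA yA').
(* A corner of order below [k] would be a better candidate: it cuts off [y] in addition to all that
   [(A, B)] cuts off. *)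
rewrite leqNgt; apply/negP => ltC.
have /maxA /= : P (A :&: A', B :|: B').
  by apply/and3P; split; [exact: separation_meet sAB sAB' | exact: ltC | rewrite subsetI XA].
apply/negP; rewrite -ltnNge; apply/proper_card/properP; split.
  by apply: setDS; apply: subsetIl.
by exists y; rewrite in_setD ?in_setI yA ?(negbTE yA') ?yC.
Qed.

(** For the lower bound, the neighbourhood has fewer than [k] vertices, so it misses some vertex of
    [X] and separates it from [v]. *)
Lemma nbh_block_comp X v :
  k_block e k X -> v \notin X -> #|nbh (comp X v)| = k - 1.
Proof.
move=> bX vX; have ltk := nbh_block_comp_lt bX vX.
apply/eqP; rewrite eqn_leq; apply/andP; split; first by lia.
have /subsetPn[z zX zN] : ~~ (X \subset nbh (comp X v)).
  by apply/negP => /subset_leq_card; have := k_block_card bX; lia.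
rewrite -nbh_order setIC.
apply: (@separation_order _ _ _ v z e_conn (separationC (nbh_separation _))).
  by rewrite inE negbK comp_refl.
rewrite inE negb_or zN andbT; apply/negP => /(comp_notin vX); by rewrite zX.
Qed.

(** Each block lies in the other's component together with its neighbourhood. If [u] violated the
    inclusion, its component D in G - X would miss [X'], so N(D) would avoid [comp X' v'] and lie in
    the neighbourhood of the latter. All these neighbourhoods have k - 1 vertices, so that one
    equals N(D) and lies in [X]; being also in [X'], it would equal [nbh (comp X v)]. *)
Lemma crossing_comp_cover X X' v v' :
  k_block e k X -> v \notin X -> k_block e k X' -> v' \notin X' ->
  ~~ [disjoint comp X v & X'] -> ~~ [disjoint comp X' v' & X] ->
  nbh (comp X v) != nbh (comp X' v') ->
  ~: comp X v \subset comp X' v' :|: nbh (comp X' v').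
Proof.
move=> bX vX bX' vX' CX' C'X.
have side Y D : k_block e k Y -> #|nbh D| < k -> ~~ [disjoint D & Y] -> Y \subset D :|: nbh D.
  move=> bY ltD DY; have := inseparable_side (k_block_inseparable bY) (nbh_separation D).
  rewrite nbh_order => /(_ ltD)/orP[//|YD].
  by rewrite disjoint_sym disjoints_subset YD in DY.
have {CX'}sX' := side _ _ bX' (nbh_block_comp_lt bX vX) CX'.
have {C'X}sX := side _ _ bX (nbh_block_comp_lt bX' vX') C'X.
have nC := nbh_comp vX; have nC' := nbh_comp vX'.
have oC := nbh_block_comp bX vX; have oC' := nbh_block_comp bX' vX'.
apply: contra_neqT => /subsetPn[u]; rewrite in_setC => uC uC'.
have uX : u \notin X by apply: contra uC'; apply: (subsetP sX).
have DX' : [disjoint comp X u & X'].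
  rewrite disjoint_subset; apply/subsetP => w wD; rewrite inE.
  apply/negP => /(subsetP sX'); rewrite in_setU => /orP[wC|/(subsetP nC)]; last first.
    by apply/negP; apply: comp_notin wD.
  by case/negP: uC; rewrite -(comp_eq wC) (comp_eq wD) comp_refl.
have /orP[/subsetP/(_ u (comp_refl _ _))|] :=
    connected_comp_or (comp_connected uX) DX' vX'.
  by move=> uC1; rewrite in_setU uC1 in uC'.
rewrite subUset => /andP[_ DC'].
have eqD : nbh (comp X u) = nbh (comp X' v').
  apply/eqP; rewrite eqEcard (nbh_block_comp bX uX) oC' leqnn andbT.
  apply/subsetP => w wD; have := subsetP sX w (subsetP (nbh_comp uX) w wD).
  by have := subsetP DC' w wD; rewrite in_setC in_setU => /negbTE->.
apply/esym/eqP; rewrite eqEcard oC oC' leqnn andbT; apply/subsetP => w wN.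
have := subsetP sX' w (subsetP nC' w wN); rewrite in_setU => /orP[wC|//].
have := comp_notin vX wC; case/negP.
by apply: (subsetP (nbh_comp uX)); rewrite eqD.
Qed.

(** If one component misses the other block, [connected_comp_or] decides. Otherwise, equal
    neighbourhoods make the components comparable or disjoint, and different ones allow
    [crossing_comp_cover] in both directions. *)
Lemma block_comps_nested C D : C \in block_comps k -> D \in block_comps k ->
  [|| sep_le (nbh_sep C) (nbh_sep D), sep_le (nbh_sep C) (flip (nbh_sep D)),
      sep_le (flip (nbh_sep C)) (nbh_sep D) | sep_le (nbh_sep D) (nbh_sep C)].
Proof.
move=> /block_compsP[X [v [bX vX ->]]] /block_compsP[X' [v' [bX' vX' ->]]].
have cC := comp_connected vX; have cC' := comp_connected vX'.
have [dC|CX'] := boolP [disjoint comp X v & X'].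
  by case/orP: (connected_comp_or cC dC vX') => [/nbh_sep_le|/nbh_sep_disjoint] ->; rewrite ?orbT.
have [dC'|C'X] := boolP [disjoint comp X' v' & X].
  case/orP: (connected_comp_or cC' dC' vX) => [/nbh_sep_le|/nbh_sep_disjoint].
    by move->; rewrite !orbT.
  by rewrite sep_le_flipr => ->; rewrite orbT.
have [eqN|neqN] := eqVneq (nbh (comp X v)) (nbh (comp X' v')).
  have [dCC|] := boolP [disjoint comp X v & comp X' v']; last first.
    case/pred0Pn => z /andP[zC zC'].
    by rewrite nbh_sep_le //; apply: connected_eq_nbh zC zC'.
  rewrite nbh_sep_disjoint ?orbT // subUset -disjoints_subset dCC eqN.
  by apply/subsetP => w; rewrite in_setC inE => /andP[].
apply/or4P; apply: Or43; rewrite /sep_le /= crossing_comp_cover //=.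
by apply: crossing_comp_cover; rewrite // eq_sym.
Qed.

Lemma block_seps_nested s r : s \in block_seps k -> r \in block_seps k ->
  [|| sep_le s r, sep_le s (flip r), sep_le (flip s) r | sep_le (flip s) (flip r)].
Proof.
move=> /block_sepsP[C BC sC] /block_sepsP[D BD rD].
have /or4P := block_comps_nested BC BD.
rewrite -[sep_le (nbh_sep D) _]sep_le_flip.
by case: sC => ->; case: rD => ->; rewrite ?flipK => -[] ->; rewrite ?orbT.
Qed.

Lemma block_seps_flip s : s \in block_seps k -> flip s \in block_seps k.
Proof.
case/block_sepsP => C BC sC; apply/block_sepsP; exists C => //.
by case: sC => ->; rewrite ?flipK; [right|left].
Qed.

Lemma block_seps_separation s : s \in block_seps k -> separation s.1 s.2.
Proof.
case/block_sepsP => C _ [] ->; last apply: separationC; exact: nbh_separation.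
Qed.

Lemma block_seps_order s : s \in block_seps k -> #|s.1 :&: s.2| < k.
Proof.
case/block_sepsP => C /block_compsP[X [v [bX vX ->]]] [] -> /=; last rewrite setIC;
  by rewrite nbh_order nbh_block_comp_lt.
Qed.

Lemma k_block_not_sub_nbh X v :
  k_block e k X -> v \notin X -> ~~ (X \subset comp X v :|: nbh (comp X v)).
Proof.
move=> bX vX; apply/negP => XC.
have /subset_leq_card : X \subset nbh (comp X v).
  apply/subsetP => x xX; have := subsetP XC x xX; rewrite in_setU => /orP[|//].
  by move/(comp_notin vX); rewrite xX.
by rewrite leqNgt (leq_trans (nbh_block_comp_lt bX vX) (k_block_card bX)).
Qed.

Lemma block_seps_proper s : s \in block_seps k -> ~~ (s.1 \subset s.2).
Proof.
case/block_sepsP => C /block_compsP[X [v [bX vX ->]]] [] -> /=.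
  by apply/subsetPn; exists v; rewrite ?in_setU ?in_setC ?comp_refl.
apply: contra (k_block_not_sub_nbh bX vX); apply: subset_trans.
by rewrite -disjoints_subset disjoint_sym comp_disjoint.
Qed.

(** For [v] outside [X], the node must point away from [comp X v], as the opposite choice would
    squeeze [X] into that component and its neighbourhood. Hence [v] is not in the part. *)
Lemma block_node_part X (t : node (block_seps k)) :
  k_block e k X -> X \subset node_part t -> node_part t = X.
Proof.
move=> bX Xt; apply/eqP; rewrite eqEsubset Xt andbT; apply/subsetP => v vt.
apply/negPn/negP => vX; pose s := nbh_sep (comp X v).
have sN : s \in block_seps k.
  by apply/block_sepsP; exists (comp X v); [apply/block_compsP; exists X, v | left].
have st : s \in val t.
  apply/negPn; rewrite -(node_flip t sN); apply: contra (k_block_not_sub_nbh bX vX) => fst.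
  exact: subset_trans Xt (bigcap_inf _ fst).
by have /bigcapP/(_ s st) := vt; rewrite in_setC comp_refl.
Qed.

End AdjacencyConditions.
End Separations.

(* Truncated subtraction agrees with the mathematics: where k - 3 or
   floor (3 (k - 2) / 2) would be negative, the truncated bound is 0, and both
   versions of the condition hold trivially. *)
Theorem theorem3p4 (k : nat) (k_ge1 : 1 <= k)
    (V : finType) (e : rel V) (e_simple : simple_graph e)
    (e_conn : n_connected e (k - 1))
    (e_adj : forall x y : V, e x y ->
       [\/ k - 3 <= #|common_neighbours e x y|,
           independent_nonedge_paths e x y ((3 * (k - 2)) %/ 2)
         | exists X : {set V}, [/\ k_block e k X, x \in X & y \in X]]) :
  exists (T : finType) (f : rel T) (part : T -> {set V}),
    [/\ tree_decomposition e f part,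
        canonical_td e f part,
        adhesion_lt f part k,
        forall t, (exists2 X : {set V}, k_block e k X & X \subset part t) ->
          k_block e k (part t)
      & (forall X : {set V}, k_block e k X -> exists t, X \subset part t) /\
        (forall (X Y : {set V}) (s t : T),
           k_block e k X -> k_block e k Y -> X <> Y ->
           X \subset part s -> Y \subset part t -> part s <> part t)].
Proof.
have [e_sym e_irr] := e_simple.
have N_flip := @block_seps_flip V e k.
have N_proper := block_seps_proper e_sym e_irr k_ge1 e_conn e_adj.
have N_sep := @block_seps_separation V e e_sym k.
have N_nested := block_seps_nested e_sym e_irr k_ge1 e_conn e_adj.
have N_order := block_seps_order e_sym e_irr k_ge1 e_conn e_adj.
have part_block := block_node_part e_sym e_irr k_ge1 e_conn e_adj.
exists (node (block_seps e k)), (@node_adj V (block_seps e k)), (@node_part V (block_seps e k)).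
split.
- by apply: nested_tree_decomposition => // s /N_sep /separationP[].
- by apply: canonical_node => a s; apply: sep_act_block_seps.
- exact: node_adhesion.
- by move=> t [X bX /(part_block X t bX) ->].
split=> [X bX|X Y s t bX bY XY Xs Yt].
  apply: (node_exists N_flip N_proper) => s sN.
  exact: inseparable_side (k_block_inseparable bX) (N_sep s sN) (N_order s sN).
by rewrite (part_block X s bX Xs) (part_block Y t bY Yt).
Qed.
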